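(* Let $n\geq 4$ be an integer that is not a prime. Then $\mu(\Gamma(\mathbb{Z}_n))=\kappa(\Gamma(\mathbb{Z}_n))$ if and only if $n$ is a product of two distinct primes or $n=p^t$ for some prime $p$ and integer $t\geq 3$.
   Context: The zero divisor graph $\Gamma(\mathbb{Z}_n)$ is the simple graph whose vertices are the nonzero zero divisors of $\mathbb{Z}_n$ (nonzero $x$ such that $xy=0$ for some nonzero $y$), two distinct vertices $x,y$ being adjacent iff $xy=0$ in $\mathbb{Z}_n$. For a finite simple graph $G$, the algebraic connectivity $\mu(G)$ is the second smallest eigenvalue (counted with multiplicity) of the Laplacian matrix $L(G)=D(G)-A(G)$, where $D(G)$ is the diagonal degree matrix and $A(G)$ the adjacency matrix. The vertex connectivity $\kappa(G)$ is the minimum number of vertices whose removal leaves an induced subgraph that is disconnected or has only one vertex. For a complete graph $K_m$ on $m$ vertices, the convention is $\mu(K_m)=m=\kappa(K_m)+1$ (this includes the one-vertex graph $\Gamma(\mathbb{Z}_4)=K_1$, for which $\kappa(K_1)=0$). *)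

(* Defs.v *)
From mathcomp Require Import all_boot all_order all_algebra all_field.

Set Implicit Arguments.
Unset Strict Implicit.
Unset Printing Implicit Defensive.

Import Order.TTheory GRing.Theory Num.Theory.
Local Open Scope ring_scope.

Record sgraph := SGraph {
  vertex :> finType;
  adj : rel vertex;
  adj_sym : symmetric adj;
  adj_irr : irreflexive adj }.

Section Graph.
Variable G : sgraph.

Definition degree (x : G) : nat := #|[set y | adj x y]|.

(* The vertices are numbered by [enum_val]; the spectrum does not depend on
   this choice. *)
Definition degree_mx : 'M[algC]_#|G| :=
  diag_mx (\row_i (degree (enum_val i))%:R).

Definition adjacency_mx : 'M[algC]_#|G| :=
  \matrix_(i, j) (adj (enum_val i) (enum_val j))%:R.

Definition laplacian : 'M[algC]_#|G| := degree_mx - adjacency_mx.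

(* The roots of the characteristic polynomial with multiplicity, in increasing
   order; [<=%R] is only a partial order on [algC], but it is total on real
   numbers and these roots are real ([laplacian_spectrum_real] below). *)
Definition laplacian_spectrum : seq algC :=
  sort <=%R (sval (closed_field_poly_normal (char_poly laplacian))).

(* A one-vertex graph has no second eigenvalue; its value is the convention
   mu(K_m) = m at m = 1.  For m >= 2 the second eigenvalue of K_m is m. *)
Definition algebraic_connectivity : algC :=
  if #|G| == 1%N then 1 else laplacian_spectrum`_1.

Definition induced_rel (A : {set G}) : rel G :=
  [rel x y | [&& x \in A, y \in A & adj x y]].

Definition induced_disconnected (A : {set G}) : bool :=
  [exists x in A, exists y in A, ~~ connect (induced_rel A) x y].

Definition separating (S : {set G}) : bool :=
  induced_disconnected (~: S) || (#|~: S| == 1%N).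

(* The default #|G| is reached only by the graph with no vertices
   ([vertex_connectivity_attained] below). *)
Definition vertex_connectivity : nat :=
  \big[Order.min/#|G|]_(S : {set G} | separating S) #|S|.

Lemma laplacian_spectrumE :
  char_poly laplacian = \prod_(z <- laplacian_spectrum) ('X - z%:P).
Proof.
rewrite /laplacian_spectrum; case: closed_field_poly_normal => r /= Dr.
by rewrite {1}Dr (monicP (char_poly_monic _)) scale1r; apply: perm_big; rewrite perm_sym perm_sort.
Qed.

Lemma size_laplacian_spectrum : size laplacian_spectrum = #|G|.
Proof.
by have := size_char_poly laplacian; rewrite laplacian_spectrumE size_prod_XsubC => -[].
Qed.

Lemma laplacian_spectrum_real : {in laplacian_spectrum, forall z, z \is Num.real}.
Proof.
move=> z z_eig; have : root (char_poly laplacian) z.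
  by rewrite laplacian_spectrumE root_prod_XsubC.
rewrite -eigenvalue_root_char => /eigenvalueP [v Dv v_neq0].
pose w := map_mx Num.conj v.
have Lconj : map_mx Num.conj laplacian = laplacian.
  by apply/matrixP => i j; rewrite !mxE rmorphB rmorphMn /= !conjC_nat.
have Ltr : laplacian^T = laplacian.
  apply/matrixP => i j; rewrite !mxE adj_sym eq_sym.
  by case: eqP => // ->.
have Dw : w *m laplacian = z^* *: w by rewrite -Lconj -map_mxM Dv map_mxZ.
have Dwt : laplacian *m w^T = z^* *: w^T by rewrite -{1}Ltr -trmx_mul Dw linearZ.
have : (z *: v) *m w^T = v *m (z^* *: w^T) by rewrite -Dv -Dwt mulmxA.
rewrite -scalemxAl -scalemxAr => /matrixP /(_ 0 0); rewrite !mxE.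
have nz : \sum_j v 0 j * w^T j 0 != 0.
  rewrite psumr_neq0 => [|j _]; last by rewrite !mxE mul_conjC_ge0.
  have [j vj] := rV0Pn _ v_neq0.
  by apply/hasP; exists j; rewrite ?mem_index_enum // !mxE mul_conjC_gt0.
by move=> /(mulIf nz) Dz; apply/CrealP.
Qed.

Lemma laplacian_spectrum_sorted : sorted <=%R laplacian_spectrum.
Proof.
apply: (@sort_sorted_in _ Num.real) => [x y /= xr yr|]; first exact: real_leVge.
apply/allP => z z_in; apply: laplacian_spectrum_real.
by rewrite mem_sort.
Qed.

Lemma vertex_connectivity_min (S : {set G}) :
  separating S -> (vertex_connectivity <= #|S|)%N.
Proof.
by move=> sepS; rewrite -leEnat; apply: bigmin_le_cond.
Qed.

Lemma vertex_connectivity_attained : (0 < #|G|)%N ->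
  exists2 S : {set G}, separating S & vertex_connectivity = #|S|.
Proof.
case/card_gt0P => x _.
have sepx : separating (~: [set x]) by rewrite /separating setCK cards1 eqxx orbT.
have : vertex_connectivity = #|G|
    \/ exists2 S : {set G}, separating S & vertex_connectivity = #|S|.
  rewrite /vertex_connectivity; elim/big_rec: _ => [|S k sepS IH]; first by left.
  rewrite /Order.min; case: ifP => _ //; by right; exists S.
case=> // DG; have : (vertex_connectivity <= #|~: [set x]|)%N.
  exact: vertex_connectivity_min.
by rewrite DG cardsC1 -ltnS prednK ?ltnn //; apply/card_gt0P; exists x.
Qed.

End Graph.

Section ZeroDivisorGraph.
Variable n : nat.

(* ['Z_n] is the ring of integers modulo n only for n >= 2. *)
Definition zero_divisor (x : 'Z_n) : bool :=
  (x != 0) && [exists y : 'Z_n, (y != 0) && (x * y == 0)].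

Definition zd_vertex := {x : 'Z_n | zero_divisor x}.

Definition zd_adj : rel zd_vertex :=
  [rel x y | (x != y) && (val x * val y == 0)].

Lemma zd_adj_sym : symmetric zd_adj.
Proof. by move=> x y; rewrite /zd_adj /= eq_sym mulrC. Qed.

Lemma zd_adj_irr : irreflexive zd_adj.
Proof. by move=> x; rewrite /zd_adj /= eqxx. Qed.

Definition zero_divisor_graph : sgraph := SGraph zd_adj_sym zd_adj_irr.

End ZeroDivisorGraph.

(* Main.v *)
(* Write mu and kappa for the algebraic and the vertex connectivity.  By the
   Rayleigh principle, mu is the minimum of the quotient
   (\sum_{xy edge} |f x - f y|^2) / (\sum_x |f x|^2) over f <> 0 of sum 0.

   If S is a cut separating the other vertices into A and B, the function #|B| on A,
   - #|A| on B, 0 on S gives mu <= #|S|, strictly unless every vertex of S is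
   adjacent to every vertex outside S.  Conversely, if a graph is the join of S
   and its complement, then mu >= min(#|S|, #|~: S|).

   If n = p q, both parts of the complete bipartite graph are cuts, and if
   n = p^t with t >= 3, the multiples of p^(t-1) form a cut joined to the
   rest, of at most half the size; so mu = kappa.  If n = p^2 the graph is complete.
   Otherwise n has prime divisors p <> q with n <> p q: p and q are not
   adjacent, and no vertex is adjacent to both, so the complement
   of the graph is connected; as the graph is connected too, it is not the
   join of a cut and its complement, and mu < kappa. *)
Require Import Defs.
From mathcomp Require Import all_boot all_order all_algebra all_field.
From mathcomp Require Import perm ring.

Set Implicit Arguments.
Unset Strict Implicit.
Unset Printing Implicit Defensive.

Import Order.TTheory GRing.Theory Num.Theory.
Local Open Scope ring_scope.
Local Open Scope sesquilinear_scope.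

(** * Characteristic polynomials and unitary matrices *)

(** Conjugation by [P] fixes the scalar matrix with entry X, and the determinants of [P] and its
    inverse cancel. *)
Lemma char_poly_conj (F : fieldType) m (P : 'M[F]_m) (d : 'rV[F]_m) : P \in unitmx ->
  char_poly (invmx P *m diag_mx d *m P) = \prod_i ('X - (d 0 i)%:P).
Proof.
move=> Pu; set M := _ *m P.
have Dd : char_poly (diag_mx d) = \prod_i ('X - (d 0 i)%:P).
  rewrite char_poly_trig ?diag_mx_is_trig //.
  by apply: eq_bigr => i _; rewrite mxE eqxx.
rewrite -Dd /char_poly /char_poly_mx.
have -> : 'X%:M - map_mx polyC M
   = map_mx polyC (invmx P) *m ('X%:M - map_mx polyC (diag_mx d)) *m map_mx polyC P.
  rewrite mulmxBr mulmxBl /M !map_mxM; congr (_ - _).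
  by rewrite mul_mx_scalar -scalemxAl -map_mxM mulVmx // map_mx1 scalemx1.
rewrite !det_mulmx mulrC mulrA -det_mulmx -map_mxM mulmxV //.
by rewrite map_mx1 det1 mul1r.
Qed.

Lemma unitary_mulK m (P : 'M[algC]_m) : P \is unitarymx -> P ^t* *m P = 1%:M.
Proof. by move=> Pu; rewrite -invmx_unitary // mulVmx ?unitarymx_unit. Qed.

Lemma sqr_normB (a b : algC) :
  `|a - b| ^+ 2 = `|a| ^+ 2 + `|b| ^+ 2 - (a * b^* + b * a^*).
Proof. by rewrite !normCK rmorphB /=; ring. Qed.

(** * The quadratic form of the Laplacian and the Rayleigh principle *)

Section Rayleigh.
Variable G : sgraph.
Implicit Types (f : G -> algC) (c : algC).

(* Every edge is counted twice. *)
Definition energy f : algC := \sum_x \sum_y (adj x y)%:R * `|f x - f y| ^+ 2.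
Definition sqnorm f : algC := \sum_x `|f x| ^+ 2.

Lemma energy_ge0 f : 0 <= energy f.
Proof.
by apply: sumr_ge0 => x _; apply: sumr_ge0 => y _; rewrite mulr_ge0 // exprn_ge0.
Qed.

Lemma sqnorm_ge0 f : 0 <= sqnorm f.
Proof. by apply: sumr_ge0 => x _; rewrite exprn_ge0. Qed.

Definition graph_row f : 'rV[algC]_#|G| := \row_i f (enum_val i).

Lemma sum_graph_row (F : G -> algC) : \sum_(i < #|G|) F (enum_val i) = \sum_x F x.
Proof. by rewrite [RHS](reindex _ (onW_bij _ (@enum_val_bij G))). Qed.

Lemma sqnormE f : sqnorm f = (graph_row f *m (graph_row f) ^t*) 0 0.
Proof.
rewrite !mxE /sqnorm -sum_graph_row; apply: eq_bigr => i _.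
by rewrite !mxE normCK.
Qed.

Lemma natr_degree (x : G) : (degree x)%:R = \sum_y (adj x y)%:R :> algC.
Proof.
rewrite /degree -sum1_card natr_sum big_mkcond /=.
by apply: eq_bigr => y _; rewrite inE; case: adj.
Qed.

(** Expanding |f x - f y|^2 splits the energy into two sums exchanged by swapping x and y, each
    equal to the Hermitian form of the Laplacian. *)
Lemma energyE f :
  energy f = (graph_row f *m laplacian G *m (graph_row f) ^t*) 0 0 *+ 2.
Proof.
set F := fun x y : G => (adj x y)%:R * (f x * (f x)^* - f x * (f y)^*) : algC.
have -> : energy f = \sum_x \sum_y (F x y + F y x).
  apply: eq_bigr => x _; apply: eq_bigr => y _.
  rewrite /F (adj_sym y x) -mulrDr; congr (_ * _).
  by rewrite normCK rmorphB mulrBl !mulrBr opprB.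
under eq_bigr do rewrite big_split.
rewrite big_split /= [X in _ + X]exchange_big /= -mulr2n; congr (_ *+ 2).
rewrite -mulmxA !mxE -sum_graph_row; apply: eq_bigr => i _; rewrite !mxE.
rewrite (eq_bigr (fun j => (i == j)%:R * ((degree (enum_val i))%:R * (f (enum_val j))^*)
   - (adj (enum_val i) (enum_val j))%:R * (f (enum_val j))^*)); last first.
  by move=> j _; rewrite !mxE mulrBl -[(degree _)%:R *+ _]mulr_natl mulrA.
rewrite big_split /= (bigD1 i) //= eqxx mul1r [X in _ * (_ + X + _)]big1 ?addr0; last first.
  by move=> j ji; rewrite eq_sym (negbTE ji) mul0r.
rewrite mulrDr sumrN mulrN.
rewrite (sum_graph_row (fun y => (adj (enum_val i) y)%:R * (f y)^*)).
rewrite natr_degree mulrCA mulr_suml mulr_sumr -sumrB.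
by apply: eq_bigr => y _; rewrite /F mulrBr !mulrA (mulrC (f _) (adj _ _)%:R).
Qed.

Lemma laplacian_hermsym : laplacian G \is hermsymmx.
Proof.
apply: realsym_hermsym; last first.
  by apply/mxOverP => i j; rewrite !mxE rpredB ?rpredMn ?rpred1.
apply/is_hermitianmxP; rewrite expr0 scale1r map_mx_id //.
by apply/matrixP => i j; rewrite !mxE adj_sym eq_sym; case: eqP => // ->.
Qed.

(** The spectral theorem gives the eigenvalues in no particular order; [s] matches them with the
    sorted spectrum, and [i0], [i1] are the places of its first two entries. *)
Lemma laplacian_diagonalization : (1 < #|G|)%N ->
  exists (P : 'M[algC]_#|G|) (d : 'rV_#|G|) (i0 i1 : 'I_#|G|),
  [/\ P \is unitarymx, laplacian G = P ^t* *m diag_mx d *m P, i0 != i1 &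
   [/\ d 0 i1 = algebraic_connectivity G, d 0 i0 <= algebraic_connectivity G &
    forall i, i != i0 -> algebraic_connectivity G <= d 0 i]].
Proof.
move=> G_gt1; have /hermitian_normalmx/orthomx_spectralP := laplacian_hermsym.
set P := spectralmx _; set d := spectral_diag _ => LE.
have Pu : P \is unitarymx by apply: spectral_unitarymx.
have := laplacian_spectrumE G; rewrite {1}LE char_poly_conj ?unitarymx_unit //.
pose t := [tuple d 0 i | i < #|G|].
have -> : \prod_i ('X - (d 0 i)%:P) = \prod_(z <- t) ('X - z%:P).
  by rewrite big_tuple; apply: eq_bigr => i _; rewrite tnth_mktuple.
move=> /prod_XsubC_eq; rewrite perm_sym => /tuple_permP [s sE].
have nthE (i : 'I_#|G|) : (laplacian_spectrum G)`_i = d 0 (s i).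
  by rewrite sE (nth_map i) ?size_enum_ord // nth_ord_enum tnth_mktuple.
have mono (i j : 'I_#|G|) : (i <= j)%N -> d 0 (s i) <= d 0 (s j).
  rewrite -!nthE; apply: (sorted_leq_nth le_trans le_refl).
  - exact: laplacian_spectrum_sorted.
  - by rewrite inE size_laplacian_spectrum.
  - by rewrite inE size_laplacian_spectrum.
pose k0 := Ordinal (ltnW G_gt1); pose k1 := Ordinal G_gt1.
have muE : algebraic_connectivity G = d 0 (s k1).
  by rewrite -nthE /algebraic_connectivity; rewrite gtn_eqF.
exists P, d, (s k0), (s k1); split; rewrite ?muE //.
- by rewrite {1}LE invmx_unitary.
- by rewrite (inj_eq perm_inj).
split=> // [|i]; first exact: mono.
rewrite -(permKV s i) (inj_eq perm_inj) => i_neq0.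
by apply: mono; rewrite /= lt0n.
Qed.

Lemma laplacian_const : laplacian G *m const_mx 1 = 0 :> 'cV_#|G|.
Proof.
apply/colP => i; rewrite !mxE.
rewrite (eq_bigr (fun j => (i == j)%:R * (degree (enum_val i))%:R
   - (adj (enum_val i) (enum_val j))%:R)); last first.
  by move=> j _; rewrite !mxE mulr1 -[(degree _)%:R *+ _]mulr_natl.
rewrite big_split /= (bigD1 i) //= eqxx mul1r [X in _ + X + _]big1 ?addr0; last first.
  by move=> j ji; rewrite eq_sym (negbTE ji) mul0r.
rewrite sumrN natr_degree (sum_graph_row (fun y => (adj (enum_val i) y)%:R)).
exact: subrr.
Qed.

(** * Coordinates in an orthonormal eigenbasis *)

Section Coordinates.
Variables (P : 'M[algC]_#|G|) (d : 'rV[algC]_#|G|).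
Hypotheses (Pu : P \is unitarymx) (LE : laplacian G = P ^t* *m diag_mx d *m P).
(** The rows of [P] are orthonormal left eigenvectors and [e] lists their entry sums, so the sum of
    [f] is a linear form in its coordinates. *)
Let e : 'cV_#|G| := P *m const_mx 1.

(** The all-one vector lies in the kernel of the Laplacian, so its coordinates vanish wherever the
    eigenvalue is nonzero. *)
Lemma diag_coord_const i : d 0 i * e i 0 = 0.
Proof.
have : diag_mx d *m e = 0.
  have DP : diag_mx d *m P = P *m laplacian G by rewrite LE !mulmxA (unitarymxP Pu) mul1mx.
  by rewrite mulmxA DP -mulmxA laplacian_const mulmx0.
by move=> /colP/(_ i); rewrite mul_diag_mx mxE => ->; rewrite mxE.
Qed.

Lemma coord_const_neq0 : (0 < #|G|)%N -> exists i, e i 0 != 0.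
Proof.
move=> G_gt0; apply/existsP; rewrite -negb_forall; apply/negP => /forallP e0.
have : P ^t* *m e = 0.
  by rewrite (_ : e = 0) ?mulmx0 //; apply/colP => i; rewrite [RHS]mxE; apply/eqP.
rewrite mulmxA unitary_mulK // mul1mx => /colP/(_ (Ordinal G_gt0)).
by rewrite !mxE => /eqP; rewrite oner_eq0.
Qed.

Variables (f : G -> algC) (c : 'rV[algC]_#|G|).
Hypothesis fE : graph_row f = c *m P.

Lemma sqnorm_coord : sqnorm f = \sum_i `|c 0 i| ^+ 2.
Proof.
rewrite sqnormE fE trmx_mul map_mxM mulmxA mulmxtVK // mxE.
by apply: eq_bigr => i _; rewrite !mxE normCK.
Qed.

Lemma energy_coord : energy f = (\sum_i d 0 i * `|c 0 i| ^+ 2) *+ 2.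
Proof.
rewrite energyE LE fE trmx_mul map_mxM !mulmxA !mulmxtVK // mul_mx_diag mxE.
congr (_ *+ 2); apply: eq_bigr => i _.
by rewrite !mxE normCK mulrA (mulrC (d 0 i)).
Qed.

Lemma sum_coord : \sum_x f x = \sum_i c 0 i * e i 0.
Proof.
have -> : \sum_x f x = (graph_row f *m const_mx 1 : 'M_1) 0 0.
  by rewrite mxE -sum_graph_row; apply: eq_bigr => i _; rewrite !mxE mulr1.
by rewrite fE -mulmxA mxE.
Qed.
End Coordinates.

(** If mu > 0, only the eigenvalue at [i0] can be 0, so the all-one vector lives on that coordinate;
    a function of sum 0 has no component there, and all other eigenvalues are at least mu. *)
Lemma rayleigh f : (1 < #|G|)%N -> \sum_x f x = 0 ->
  (algebraic_connectivity G * sqnorm f) *+ 2 <= energy f.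
Proof.
move=> G_gt1 f0; have [P [d [i0 [i1 [Pu LE i01 [d1 d0 dge]]]]]] :=
  laplacian_diagonalization G_gt1.
set mu := algebraic_connectivity G in d1 d0 dge *.
have mu_real : mu \is Num.real.
  apply: (@laplacian_spectrum_real G); rewrite /mu /algebraic_connectivity.
  by rewrite gtn_eqF // mem_nth // size_laplacian_spectrum.
(* For mu <= 0 the bound is trivial, the energy being nonnegative. *)
have [mu_le0|mu_gt0] := real_leP mu_real (real0 _).
  apply: le_trans (energy_ge0 f); rewrite mulrn_wle0 // mulr_le0_ge0 //.
  exact: sqnorm_ge0.
pose c := graph_row f *m P ^t*.
have fE : graph_row f = c *m P by rewrite -mulmxA unitary_mulK // mulmx1.
have e0 i : i != i0 -> (P *m const_mx 1 : 'cV_#|G|) i 0 = 0.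
  move=> ii0; have /eqP := diag_coord_const Pu LE i; rewrite mulf_eq0.
  by case/orP=> /eqP // di; have := lt_le_trans mu_gt0 (dge i ii0); rewrite di ltxx.
have c0 : c 0 i0 = 0.
  have := sum_coord fE; rewrite f0 (bigD1 i0) //= big1 ?addr0; last first.
    by move=> i ii0; rewrite e0 // mulr0.
  move/esym/eqP; rewrite mulf_eq0 => /orP [/eqP //|/eqP e00].
  have [i] := coord_const_neq0 Pu (ltnW G_gt1).
  by have [->|/e0 ->] := eqVneq i i0; rewrite ?e00 eqxx.
rewrite (energy_coord Pu LE fE) (sqnorm_coord Pu fE) lerMn2r /= mulr_sumr.
apply: ler_sum => i _; have [->|ii0] := eqVneq i i0.
  by rewrite c0 normr0 expr0n /= !mulr0.
by rewrite ler_wpM2r ?exprn_ge0 // dge.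
Qed.

(** On the span of the two lowest eigenvectors the Rayleigh quotient is at most mu, so one nonzero
    vector of sum 0 in it suffices as a test. *)
Lemma le_algebraic_connectivity c : (1 < #|G|)%N ->
  (forall f, \sum_x f x = 0 -> (c * sqnorm f) *+ 2 <= energy f) ->
  c <= algebraic_connectivity G.
Proof.
move=> G_gt1 c_le; have [P [d [i0 [i1 [Pu LE i01 [d1 d0 _]]]]]] :=
  laplacian_diagonalization G_gt1.
pose e : 'cV_#|G| := P *m const_mx 1.
(* One linear condition on two coefficients has a nonzero solution. *)
have [a [b [ab0 ab]]] : exists a b, a * e i0 0 + b * e i1 0 = 0 /\ (a != 0) || (b != 0).
  have [e0|e0] := eqVneq (e i0 0) 0.
    by exists 1, 0; rewrite e0 mulr0 mul0r addr0 oner_eq0.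
  exists (e i1 0), (- e i0 0); rewrite oppr_eq0 e0 orbT mulNr.
  by rewrite (mulrC (e i1 0)) subrr.
(* Some vector in the span of the two lowest eigenvectors has sum 0. *)
pose v := (a *: delta_mx 0 i0 + b *: delta_mx 0 i1 : 'rV[algC]_#|G|).
have v0 : v 0 i0 = a.
  by rewrite !mxE !eqxx (negbTE i01) mulr1 mulr0 addr0.
have v1 : v 0 i1 = b.
  by rewrite !mxE !eqxx eq_sym (negbTE i01) mulr1 mulr0 add0r.
have vsum (F : algC -> 'I_#|G| -> algC) : (forall i, F 0 i = 0) ->
    \sum_i F (v 0 i) i = F a i0 + F b i1.
  move=> F0; rewrite (bigD1 i0) // (bigD1 i1) 1?eq_sym //= v0 v1 big1 ?addr0 //.
  move=> i /andP[ii0 ii1]; rewrite !mxE (negbTE ii0) (negbTE ii1) !mulr0 addr0.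
  exact: F0.
pose f x := (v *m P) 0 (enum_rank x).
have fE : graph_row f = v *m P by apply/rowP => i; rewrite mxE /f enum_valK.
have := c_le f; rewrite (energy_coord Pu LE fE) (sqnorm_coord Pu fE) lerMn2r /=.
rewrite (sum_coord fE) (vsum (fun z i => z * e i 0)); last by move=> i; rewrite mul0r.
rewrite (vsum (fun z i => `|z| ^+ 2)); last by move=> i; rewrite normr0 expr0n.
rewrite (vsum (fun z i => d 0 i * `|z| ^+ 2)); last first.
  by move=> i; rewrite normr0 expr0n mulr0.
move=> /(_ ab0) le_ab; rewrite -(@ler_pM2r _ (`|a| ^+ 2 + `|b| ^+ 2)).
  apply: le_trans le_ab _; rewrite d1 mulrDr lerD2r.
  by rewrite ler_wpM2r ?exprn_ge0.
rewrite lt0r addr_ge0 ?exprn_ge0 // andbT paddr_eq0 ?exprn_ge0 //.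
by rewrite !expf_eq0 /= !normr_eq0 negb_and.
Qed.
End Rayleigh.

(** * Joins, cuts and the two connectivities *)

Section Cuts.
Variable G : sgraph.
Implicit Types (f : G -> algC) (c : algC) (S : {set G}).

Lemma energy_cut f S :
  energy f = \sum_(x in S) \sum_(y in S) (adj x y)%:R * `|f x - f y| ^+ 2
    + \sum_(x in ~: S) \sum_(y in ~: S) (adj x y)%:R * `|f x - f y| ^+ 2
    + (\sum_(x in S) \sum_(y in ~: S) (adj x y)%:R * `|f x - f y| ^+ 2) *+ 2.
Proof.
pose F x y : algC := (adj x y)%:R * `|f x - f y| ^+ 2.
have splitS (H : G -> algC) : \sum_x H x = \sum_(x in S) H x + \sum_(x in ~: S) H x.
  by rewrite (bigID [in S]) /=; congr (_ + _); apply: eq_bigl => x; rewrite inE.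
rewrite /energy splitS; under eq_bigr do rewrite splitS.
under [X in _ + X = _]eq_bigr do rewrite splitS.
rewrite !big_split /= [X in _ + (X + _) = _]exchange_big /=.
rewrite [X in _ + (X + _) = _](_ : _ = \sum_(x in S) \sum_(y in ~: S) F x y).
  by rewrite /F mulr2n -!addrA; congr (_ + _); rewrite [RHS]addrC -addrA.
by apply: eq_bigr => x _; apply: eq_bigr => y _; rewrite /F adj_sym distrC.
Qed.

Lemma sqnorm_cut f S :
  sqnorm f = \sum_(x in S) `|f x| ^+ 2 + \sum_(x in ~: S) `|f x| ^+ 2.
Proof.
rewrite /sqnorm (bigID [in S]) /=; congr (_ + _).
by apply: eq_bigl => x; rewrite inE.
Qed.

Lemma join_le_algebraic_connectivity S c : (1 < #|G|)%N ->
  {in S & ~: S, forall x y, adj x y} ->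
  c <= #|S|%:R -> c <= #|~: S|%:R -> c <= algebraic_connectivity G.
Proof.
move=> G_gt1 joinS c_leS c_leT; apply: le_algebraic_connectivity => // f f0.
rewrite (energy_cut f S); apply: ler_wpDl.
  by apply: addr_ge0; do 2![apply: sumr_ge0 => ? _]; rewrite mulr_ge0 ?exprn_ge0.
rewrite lerMn2r /=; set sS := \sum_(x in S) f x.
have sT : \sum_(x in ~: S) f x = - sS.
  apply: (addrI sS); rewrite subrr -[RHS]f0 [RHS](bigID [in S]) /=; congr (_ + _).
  by apply: eq_bigl => x; rewrite inE.
have -> : \sum_(x in S) \sum_(y in ~: S) (adj x y)%:R * `|f x - f y| ^+ 2 =
    #|~: S|%:R * (\sum_(x in S) `|f x| ^+ 2)
    + #|S|%:R * (\sum_(y in ~: S) `|f y| ^+ 2) + (`|sS| ^+ 2) *+ 2.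
  transitivity (\sum_(x in S) \sum_(y in ~: S)
     (`|f x| ^+ 2 + `|f y| ^+ 2 - (f x * (f y)^* + f y * (f x)^*))).
    apply: eq_bigr => x xS; apply: eq_bigr => y yS.
    by rewrite joinS // mul1r sqr_normB.
  under eq_bigr do rewrite big_split /= big_split /= sumrN big_split /=.
  rewrite !big_split /= sumrN big_split /=; congr (_ + _ + _).
  - by rewrite mulr_sumr; apply: eq_bigr => x _; rewrite sumr_const mulr_natl.
  - by rewrite sumr_const mulr_natl.
  under eq_bigr do rewrite -mulr_sumr -rmorph_sum sT.
  rewrite -mulr_suml; under [X in - (_ + X)]eq_bigr do rewrite -mulr_suml sT.
  by rewrite -mulr_sumr -rmorph_sum -/sS rmorphN mulrN mulNr -opprD opprK -normCK mulr2n.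
rewrite (sqnorm_cut f S) mulrDr -[leLHS]addr0 lerD ?mulrn_wge0 ?exprn_ge0 //.
by rewrite lerD // ler_wpM2r // sumr_ge0 // => *; rewrite exprn_ge0.
Qed.

(** For sum 0 the mixed terms cancel, and the energy is exactly twice #|G| times the square norm. *)
Lemma complete_le_algebraic_connectivity : (1 < #|G|)%N ->
  (forall x y : G, x != y -> adj x y) -> #|G|%:R <= algebraic_connectivity G.
Proof.
move=> G_gt1 complete; apply: le_algebraic_connectivity => // f f0.
have -> : energy f = \sum_x \sum_y
     (`|f x| ^+ 2 + `|f y| ^+ 2 - (f x * (f y)^* + f y * (f x)^*)).
  apply: eq_bigr => x _; apply: eq_bigr => y _.
  (* The pairs x = y may be included, since their term is 0. *)
  transitivity (`|f x - f y| ^+ 2).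
    have [->|xy] := eqVneq x y; last by rewrite complete // mul1r.
    by rewrite subrr normr0 expr0n mulr0.
  exact: sqr_normB.
have f0C : \sum_x (f x)^* = 0 by rewrite -rmorph_sum f0 rmorph0.
rewrite (eq_bigr (fun x => `|f x| ^+ 2 *+ #|G| + sqnorm f)); last first.
  move=> x _; rewrite !big_split /= sumrN big_split /= -[X in _ - (X + _)]mulr_sumr.
  by rewrite -[X in _ - (_ + X)]mulr_suml f0 f0C mulr0 mul0r addr0 subr0 sumr_const.
by rewrite big_split /= sumr_const sumrMnl mulr2n mulr_natl.
Qed.

(* [f] is locally constant off [S], so only the edges meeting [S] contribute. *)
Lemma cut_vector S : induced_disconnected (~: S) ->
  exists f, [/\ \sum_x f x = 0, {in S, forall x, f x = 0},
    {in ~: S, forall x, f x != 0} &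
    energy f = (\sum_(x in S) \sum_(y in ~: S) (adj x y)%:R * `|f y| ^+ 2) *+ 2].
Proof.
case/exists_inP => x xT /exists_inP [y yT ncxy].
(* One side of the cut is the component of [x]; the other consists of all remaining vertices off
   [S], [y] among them. *)
pose comp z := connect (induced_rel (~: S)) x z.
pose a := #|[set z in ~: S | comp z]|; pose b := #|[set z in ~: S | ~~ comp z]|.
have a0 : (0 < a)%N by apply/card_gt0P; exists x; rewrite !inE /comp connect0 -in_setC xT.
have b0 : (0 < b)%N by apply/card_gt0P; exists y; rewrite !inE ncxy -in_setC yT.
have compE : {in ~: S &, forall u v, adj u v -> comp u = comp v}.
  move=> u v uT vT uv; apply/idP/idP => /connect_trans; apply; apply: connect1.
    by apply/and3P.
  by apply/and3P; rewrite adj_sym.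
pose f z : algC := if z \in S then 0 else if comp z then b%:R else - a%:R.
have fS z : z \in S -> f z = 0 by rewrite /f => ->.
have fT z : z \in ~: S -> f z = if comp z then b%:R else - a%:R.
  by rewrite inE /f => /negbTE ->.
exists f; split=> //.
- rewrite (bigID [in S]) /= big1 ?add0r //.
  rewrite (bigID comp) /=.
  rewrite (eq_bigr (fun=> b%:R)); last by move=> z /andP[zS cz]; rewrite fT ?inE // cz.
  rewrite [X in _ + X](eq_bigr (fun=> - a%:R)); last first.
    by move=> z /andP[zS /negbTE cz]; rewrite fT ?inE // cz.
  have cardE (p : pred G) : #|[pred z | (z \notin S) && p z]| = #|[set z in ~: S | p z]|.
    by apply: eq_card => z; rewrite !inE.
  by rewrite !sumr_const !cardE -/a -/b mulNrn -!mulrnA mulnC subrr.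
- by move=> z zT; rewrite fT //; case: ifP; rewrite ?oppr_eq0 pnatr_eq0 -lt0n.
rewrite (energy_cut f S) big1 ?add0r; last first.
  by move=> u uS; apply: big1 => v vS; rewrite !fS // subrr normr0 expr0n mulr0.
rewrite big1 ?add0r; last first.
  move=> u uT; apply: big1 => v vT; case uv: (adj u v); last by rewrite mul0r.
  by rewrite !fT // (compE _ _ uT vT uv) subrr normr0 expr0n mulr0.
by congr (_ *+ 2); apply: eq_bigr => u uS; apply: eq_bigr => v _; rewrite fS // sub0r normrN.
Qed.

Lemma disconnected_card_gt1 S : induced_disconnected S -> (1 < #|G|)%N.
Proof.
case/exists_inP => x xS /exists_inP [y yS ncxy].
apply/card_gt1P; exists x, y; split=> //.
by apply: contraNneq ncxy => ->.
Qed.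

(** For the cut vector, half the energy is #|S| N minus [gap], the contribution of the missing edges
    between [S] and the rest. The Rayleigh bound then gives gap <= (#|S| - mu) N; at equality every
    term of [gap] is 0, and since [f] does not vanish off [S], no edge is missing. *)
Lemma algebraic_connectivity_cut S : induced_disconnected (~: S) ->
  algebraic_connectivity G <= #|S|%:R /\
  (algebraic_connectivity G = #|S|%:R -> {in S & ~: S, forall x y, adj x y}).
Proof.
move=> disS; have G_gt1 := disconnected_card_gt1 disS.
have [f [f0 fS fT energy_f]] := cut_vector disS.
set mu := algebraic_connectivity G.
pose N := \sum_(y in ~: S) `|f y| ^+ 2.
have sqnorm_f : sqnorm f = N.
  rewrite (sqnorm_cut f S) big1 ?add0r // => x xS.
  by rewrite fS // normr0 expr0n.
pose gap := \sum_(x in S) \sum_(y in ~: S) (~~ adj x y)%:R * `|f y| ^+ 2.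
have gap_term x y : 0 <= (~~ adj x y)%:R * `|f y| ^+ 2 by rewrite mulr_ge0 ?exprn_ge0.
have gap_le : gap <= (#|S|%:R - mu) * N.
  have := rayleigh G_gt1 f0; rewrite energy_f lerMn2r /= sqnorm_f mulrBl => mu_le.
  rewrite -/mu lerBrDr (le_trans (lerD (lexx _) mu_le)) //.
  (* Each vertex of [S] accounts for one copy of N, shared between its neighbours and non-neighbours
     off [S]. *)
  rewrite mulr_natl -sumr_const -big_split; apply: ler_sum => x _ /=.
  rewrite -big_split; apply: ler_sum => y _ /=.
  by rewrite -mulrDl; case: (adj x y); rewrite ?add0r ?addr0 mul1r.
have N_gt0 : 0 < N.
  case/exists_inP: disS => x xT _; rewrite /N (bigD1 x) //= ltr_wpDr //.
    by apply: sumr_ge0 => *; rewrite exprn_ge0.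
  by rewrite exprn_gt0 // normr_gt0 fT.
have gap_ge0 : 0 <= gap by apply: sumr_ge0 => x _; apply: sumr_ge0.
split=> [|muE x y xS yT].
  by rewrite -subr_ge0 -(pmulr_lge0 _ N_gt0) (le_trans gap_ge0).
move: gap_le; rewrite -/mu muE subrr mul0r => gap_le.
have /eqP : gap = 0 by apply/le_anti/andP.
rewrite psumr_eq0 => [/allP/(_ x (mem_index_enum x))|i _]; last exact: sumr_ge0.
rewrite xS /= psumr_eq0 // => /allP/(_ y (mem_index_enum y)).
rewrite yT /= mulf_eq0 expf_eq0 /= normr_eq0 (negbTE (fT y yT)) orbF pnatr_eq0.
by case: (adj x y).
Qed.

Lemma isolated_disconnected (A : {set G}) x y : x \in A -> y \in A -> x != y ->
  {in A, forall z, ~~ adj x z} -> induced_disconnected A.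
Proof.
move=> xA yA xy isol_x; apply/exists_inP; exists x => //; apply/exists_inP; exists y => //.
apply/negP => /connectP [[|z p] /=]; first by move=> _ yx; rewrite yx eqxx in xy.
by case/andP => /and3P[_ /isol_x /negbTE->].
Qed.

(** If [A] has a second vertex it is disconnected; otherwise the one-vertex clause of [separating]
    applies. *)
Lemma isolated_separating (A : {set G}) x : x \in A ->
  {in A, forall y, ~~ adj x y} -> separating (~: A).
Proof.
move=> xA isol_x; rewrite /separating setCK.
have [|] := boolP [exists y in A, x != y].
  by case/exists_inP => y yA xy; rewrite (isolated_disconnected xA yA).
rewrite negb_exists_in => /forall_inP Ax; apply/orP; right; apply/cards1P; exists x.
apply/setP => y; rewrite inE; apply/idP/eqP => [yA|-> //].
by apply/esym/eqP; rewrite -[_ == _]negbK Ax.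
Qed.

Lemma vertex_connectivity_lt : (0 < #|G|)%N -> (vertex_connectivity G < #|G|)%N.
Proof.
case/card_gt0P => x _; have sepx : separating (~: [set x]).
  by rewrite /separating setCK cards1 eqxx orbT.
apply: leq_ltn_trans (vertex_connectivity_min sepx) _.
by rewrite cardsC1 prednK //; apply/card_gt0P; exists x.
Qed.

(** A separating set that leaves one vertex has #|G| - 1 elements, but removing everything except
    [x] and [y] takes only #|G| - 2, so a minimum one really disconnects. *)
Lemma min_cut_disconnected (x y : G) : x != y -> ~~ adj x y ->
  exists2 S : {set G}, induced_disconnected (~: S) & vertex_connectivity G = #|S|.
Proof.
move=> xy nadj; have [|S /orP[disS|/eqP sing] kE] := @vertex_connectivity_attained G.
- by apply/card_gt0P; exists x.
- by exists S.
have sepxy : separating (~: [set x; y]).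
  apply: (@isolated_separating _ x); first by rewrite !inE eqxx.
  by move=> z; rewrite !inE => /orP[] /eqP-> //; rewrite adj_irr.
have := vertex_connectivity_min sepxy; rewrite kE.
have := cardsC S; have := cardsC [set x; y]; rewrite cards2 xy sing => <-.
by rewrite addn1 add2n => -[->]; rewrite ltnn.
Qed.

Lemma algebraic_connectivity_le_vertex_connectivity (x y : G) : x != y -> ~~ adj x y ->
  algebraic_connectivity G <= (vertex_connectivity G)%:R.
Proof.
move=> xy nadj; have [S disS ->] := min_cut_disconnected xy nadj.
by have [] := algebraic_connectivity_cut disS.
Qed.
End Cuts.

Lemma induced_relT (G : sgraph) (x y : G) : induced_rel [set: G] x y = adj x y.
Proof. by rewrite /induced_rel /= !inE. Qed.

(** * Vertices of the zero divisor graph as natural numbers *)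

Section ZeroDivisors.
Variable n : nat.
Hypothesis n_gt1 : (1 < n)%N.
Local Notation Gamma := (zero_divisor_graph n).
Implicit Types u v : Gamma.

(** Taking representatives below n turns vanishing products into divisibility by n. *)
Definition residue v : nat := (val v : 'Z_n).

Lemma Zn_nat_eq0 k : ((k%:R : 'Z_n) == 0) = (n %| k)%N.
Proof. by rewrite -val_eqE /= val_Zp_nat. Qed.

Lemma Zn_mul_eq0 (x y : 'Z_n) : (x * y == 0) = (n %| x * y)%N.
Proof.
by rewrite -[x]natr_Zp -[y]natr_Zp -natrM Zn_nat_eq0 !natr_Zp.
Qed.

Lemma residue_inj : injective residue.
Proof. by move=> u v /val_inj /val_inj. Qed.

Lemma residue_gt0 v : (0 < residue v)%N.
Proof. by have /andP[v0 _] := valP v; move: v0; rewrite -val_eqE lt0n. Qed.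

Lemma residue_lt v : (residue v < n)%N.
Proof. by rewrite /residue; have := ltn_ord (val v); rewrite [X in (_ < X)%N]Zp_cast. Qed.

Lemma residue_ndvd v : ~~ (n %| residue v)%N.
Proof. by rewrite gtnNdvd ?residue_gt0 ?residue_lt. Qed.

Lemma adjE u v : adj u v = (u != v) && (n %| residue u * residue v)%N.
Proof. by rewrite /= /zd_adj /= Zn_mul_eq0. Qed.

(** Were the residue coprime to n, n would divide the cofactor y, although 0 < y < n. *)
Lemma residue_prime v : exists p, [/\ prime p, (p %| n)%N & (p %| residue v)%N].
Proof.
have [cop|] := boolP (coprime (residue v) n).
  have /andP[_ /existsP[y /andP[y0]]] := valP v.
  rewrite Zn_mul_eq0 Gauss_dvdr 1?coprime_sym // => /dvdn_leq.
  rewrite lt0n leqNgt; have := ltn_ord y; rewrite [X in (_ < X)%N]Zp_cast // => ->.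
  by move/(_ y0).
rewrite /coprime => gcd_neq1; have := pdiv_prime (_ : 1 < gcdn (residue v) n)%N.
have gcd_gt1 : (1 < gcdn (residue v) n)%N.
  by rewrite ltn_neqAle eq_sym gcd_neq1 gcdn_gt0 residue_gt0.
move/(_ gcd_gt1) => p_pr; exists (pdiv (gcdn (residue v) n)); split=> //.
  exact: dvdn_trans (pdiv_dvd _) (dvdn_gcdr _ _).
exact: dvdn_trans (pdiv_dvd _) (dvdn_gcdl _ _).
Qed.

(** The nonzero class of n / p annihilates every multiple of p. *)
Lemma vertex_of_multiple p k : prime p -> (p %| n)%N -> (p %| k)%N -> ~~ (n %| k)%N ->
  exists v, residue v = (k %% n)%N.
Proof.
move=> p_pr pn pk nk.
have kV : @zero_divisor n k%:R.
  rewrite /zero_divisor Zn_nat_eq0 nk; apply/existsP; exists (n %/ p)%:R.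
  rewrite -natrM !Zn_nat_eq0 -[X in (X %| k * _)%N](divnK pn) mulnC dvdn_mul // andbT.
  have n_gt0 := ltnW n_gt1.
  by rewrite gtnNdvd ?divn_gt0 ?prime_gt0 ?ltn_Pdiv ?prime_gt1 // dvdn_leq.
by exists (Sub k%:R kV); rewrite /residue /= val_Zp_nat.
Qed.

Lemma vertex_of_lt p k : prime p -> (p %| n)%N -> (p %| k)%N -> (0 < k < n)%N ->
  exists v, residue v = k.
Proof.
move=> p_pr pn pk /andP[k_gt0 k_lt]; have [|v vE] := vertex_of_multiple p_pr pn pk.
  by rewrite gtnNdvd.
by exists v; rewrite vE modn_small.
Qed.

(** * The families p^2, p q and p^t *)

(** Every residue is a multiple of p, so the graph is complete and mu >= #|Gamma| > kappa. *)
Lemma zero_divisor_graph_complete p : prime p -> n = (p ^ 2)%N ->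
  algebraic_connectivity Gamma != (vertex_connectivity Gamma)%:R.
Proof.
move=> p_pr nE.
have pres v : (p %| residue v)%N.
  have [q [q_pr]] := residue_prime v.
  by rewrite nE Euclid_dvdX // dvdn_prime2 // => /andP[/eqP->].
have complete u v : u != v -> adj u v.
  by move=> uv; rewrite adjE uv nE expnS expn1 dvdn_mul.
have [v _] : exists v, residue v = p.
  apply: (vertex_of_lt p_pr); rewrite ?nE ?dvdn_exp //.
  by rewrite prime_gt0 // -{1}(expn1 p) ltn_exp2l ?prime_gt1.
have G_gt0 : (0 < #|Gamma|)%N by apply/card_gt0P; exists v.
have kappa_lt := vertex_connectivity_lt G_gt0.
have mu_ge : #|Gamma|%:R <= algebraic_connectivity Gamma.
  (* The one-vertex case is n = 4, where mu = 1 by convention. *)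
  have [G1|G_gt1] := leqP #|Gamma| 1.
    have {}G1 : #|Gamma| = 1%N by apply/eqP; rewrite eqn_leq G1.
    by rewrite /algebraic_connectivity G1.
  exact: complete_le_algebraic_connectivity.
by rewrite gt_eqF // (lt_le_trans _ mu_ge) // ltr_nat.
Qed.

Lemma zero_divisor_graph_bipartite p q : prime p -> prime q -> (p < q)%N -> n = (p * q)%N ->
  algebraic_connectivity Gamma = (vertex_connectivity Gamma)%:R.
Proof.
move=> p_pr q_pr pq nE.
have pn : (p %| n)%N by rewrite nE dvdn_mulr.
have qn : (q %| n)%N by rewrite nE dvdn_mull.
have cop_pq : coprime p q by rewrite prime_coprime // dvdn_prime2 // ltn_eqF.
have [p_gt0 q_gt2] : (0 < p)%N /\ (2 < q)%N.
  by rewrite prime_gt0 // (leq_ltn_trans _ pq) ?prime_gt1.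
have not_both v : (p %| residue v)%N -> ~~ (q %| residue v)%N.
  by move=> pv; apply: contra (residue_ndvd v) => qv; rewrite nE Gauss_dvd ?pv.
have [a aE] : exists v, residue v = p.
  by apply: (vertex_of_lt p_pr); rewrite // nE p_gt0 ltn_Pmulr // ltnW.
(* As q > 2, the number 2 p is below n; it is a second vertex in the part of p, not adjacent to
   p. *)
have [a' a'E] : exists v, residue v = (2 * p)%N.
  apply: (vertex_of_lt p_pr); rewrite ?dvdn_mull // nE muln_gt0 p_gt0 /= mulnC.
  by rewrite ltn_pmul2l.
have [b bE] : exists v, residue v = q.
  by apply: (vertex_of_lt q_pr); rewrite // nE prime_gt0 ?ltn_Pmull ?prime_gt1 ?prime_gt0.
pose S : {set Gamma} := [set v | (p %| residue v)%N].
have in_S v : (v \in S) = (p %| residue v)%N by rewrite inE.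
have in_T v : (v \in ~: S) = (q %| residue v)%N.
  rewrite inE in_S; apply/idP/idP => [pv|qv]; last by apply: contraL qv => /not_both.
  have [r [r_pr]] := residue_prime v; rewrite nE Euclid_dvdM // (dvdn_prime2 r_pr p_pr) (dvdn_prime2 r_pr q_pr).
  by case/orP => /eqP-> //; rewrite (negbTE pv).
have joinS : {in S & ~: S, forall x y, adj x y}.
  move=> x y xS yT; rewrite adjE {2}nE; apply/andP; split.
    by apply: contraTneq xS => ->; rewrite inE in yT.
  by rewrite dvdn_mul -?in_S -?in_T.
have indepS : {in S &, forall x y, ~~ adj x y}.
  move=> x y; rewrite !in_S adjE => /not_both qx /not_both qy.
  apply/nandP; right; apply: contra qx => /(dvdn_trans qn).
  by rewrite Euclid_dvdM // (negbTE qy) orbF.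
have indepT : {in ~: S &, forall x y, ~~ adj x y}.
  move=> x y; rewrite !in_T adjE => qx qy.
  apply/nandP; right; apply/negP => /(dvdn_trans pn).
  by rewrite Euclid_dvdM // => /orP[] /not_both; rewrite ?qx ?qy.
have [aS a'S] : a \in S /\ a' \in S by rewrite !in_S aE a'E dvdn_mull.
have bT : b \in ~: S by rewrite in_T bE.
have aa' : a != a'.
  by apply/eqP => /(congr1 residue)/eqP; rewrite aE a'E -{1}(mul1n p) eqn_pmul2r.
(* For p = 2 the other part is the single vertex q, and removing [S] separates by the one-vertex
   clause. *)
have sepT : separating S.
  by rewrite -(setCK S); apply: (isolated_separating bT) => y; apply: indepT.
have sepS : separating (~: S) by apply: (isolated_separating aS) => y; apply: indepS.
apply/le_anti/andP; split.
  exact: (algebraic_connectivity_le_vertex_connectivity aa') (indepS _ _ aS a'S).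
apply: (join_le_algebraic_connectivity _ joinS).
- by apply/card_gt1P; exists a, a'.
- by rewrite ler_nat vertex_connectivity_min.
- by rewrite ler_nat vertex_connectivity_min.
Qed.

(** With t = s + 1, all neighbours of the vertex p are multiples of p^s, so these form a cut [S]. It
    is joined to the rest and no larger than it, hence mu >= #|S| >= kappa. *)
Lemma zero_divisor_graph_prime_power p t : prime p -> (3 <= t)%N -> n = (p ^ t)%N ->
  algebraic_connectivity Gamma = (vertex_connectivity Gamma)%:R.
Proof.
move=> p_pr; case: t => [//|s] s_ge2 nE; rewrite ltnS in s_ge2.
have p_gt1 := prime_gt1 p_pr; have p_gt0 := ltnW p_gt1.
have psn : (p ^ s %| n)%N by rewrite nE dvdn_exp2l.
have pps : (p %| p ^ s)%N by rewrite dvdn_exp // ltnW.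
have pn := dvdn_trans pps psn.
have p_lt : (p < p ^ s)%N by rewrite -{1}(expn1 p) ltn_exp2l.
have ps_ndvd : ~~ (p ^ s %| p)%N by rewrite gtnNdvd.
have pres v : (p %| residue v)%N.
  have [q [q_pr]] := residue_prime v.
  by rewrite nE Euclid_dvdX // dvdn_prime2 // => /andP[/eqP->].
pose S : {set Gamma} := [set v | (p ^ s %| residue v)%N].
have in_S v : (v \in S) = (p ^ s %| residue v)%N by rewrite inE.
have in_T v : (v \in ~: S) = ~~ (p ^ s %| residue v)%N by rewrite !inE.
have joinS : {in S & ~: S, forall x y, adj x y}.
  move=> x y xS yT; rewrite adjE {2}nE expnSr; apply/andP; split.
    by apply: contraTneq xS => ->; rewrite inE in yT.
  by rewrite dvdn_mul // -in_S.
(* A multiple of p^s plus p stays off [S], because s >= 2 keeps p^s from dividing p. *)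
have p_in k : (p ^ s %| k)%N -> exists2 v, v \in ~: S & residue v = ((k + p) %% n)%N.
  move=> psk.
  have [|||v vE] := @vertex_of_multiple p (k + p) p_pr.
  - by [].
  - by rewrite dvdn_add // (dvdn_trans pps).
  - by apply: contra ps_ndvd => /(dvdn_trans psn); rewrite dvdn_addr.
  by exists v; rewrite // in_T vE /dvdn modn_dvdm // -/(dvdn _ _) dvdn_addr.
have [a aT] := p_in 0%N (dvdn0 _).
have p_lt_n : (p < n)%N by rewrite (leq_trans p_lt) // nE leq_exp2l.
rewrite add0n modn_small // => aE.
(* Besides p itself, p^s + p is a vertex off [S]; the two are not adjacent. *)
have [a' a'T] := p_in (p ^ s)%N (dvdnn _).
rewrite modn_small => [a'E|]; last first.
  rewrite (@leq_trans (p ^ s + p ^ s)) ?ltn_add2l // nE expnS addnn -mul2n.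
  by rewrite leq_mul2r p_gt1 orbT.
have aa' : a != a'.
  apply/eqP => /(congr1 residue)/eqP; rewrite aE a'E -{1}(add0n p) eqn_add2r eq_sym.
  by rewrite expn_eq0 -leqn0 leqNgt p_gt0.
have isol_a : {in ~: S, forall y, ~~ adj a y}.
  move=> y yT; rewrite adjE aE; apply/nandP; right; move: yT; rewrite in_T.
  by apply: contra; rewrite {1}nE expnS dvdn_pmul2l.
have sepS : separating S by rewrite -(setCK S); apply: (isolated_separating aT).
(* Adding [p] sends the multiples of [p ^ s] outside [S], injectively. *)
pose h v := oapp id a [pick w in ~: S | residue w == (residue v + p) %% n]%N.
(* On [S] the choice succeeds by [p_in], so the default [a] is never taken there. *)
have hP v : v \in S -> h v \in ~: S /\ residue (h v) = ((residue v + p) %% n)%N.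
  rewrite in_S => /p_in[w wT wE]; rewrite /h; case: pickP => [x /andP[xT /eqP]|] //.
  by move/(_ w); rewrite wT wE eqxx.
have leST : (#|S| <= #|~: S|)%N.
  have /card_in_imset <- : {in S &, injective h}.
    move=> u v uS vS huv; have [[_ hu] [_ hv]] := (hP u uS, hP v vS).
    have /eqP := hu; rewrite huv hv eqn_modDr !modn_small ?residue_lt // => /eqP.
    by move/residue_inj.
  by apply/subset_leq_card/subsetP => _ /imsetP[v vS ->]; have [] := hP v vS.
apply/le_anti/andP; split.
  exact: (algebraic_connectivity_le_vertex_connectivity aa') (isol_a _ a'T).
apply: (@le_trans _ _ #|S|%:R); first by rewrite ler_nat vertex_connectivity_min.
apply: (join_le_algebraic_connectivity _ joinS); rewrite ?ler_nat //.
by apply/card_gt1P; exists a, a'.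
Qed.

(** * Connectedness, and the remaining n with two prime divisors *)

(** A multiple of p is adjacent or equal to n / p, and for distinct primes p, q dividing n the
    product of n / p and n / q is a multiple of n. As n is composite, n / p > 1 is a vertex. *)
Lemma zero_divisor_graph_connected : ~~ prime n ->
  forall u v, connect (induced_rel [set: Gamma]) u v.
Proof.
move=> n_comp; set e := induced_rel _.
have e_sym : connect_sym e.
  by apply: sym_connect_sym => x y; rewrite /e !induced_relT adj_sym.
have connect_dvd u v : (n %| residue u * residue v)%N -> connect e u v.
  move=> uv; have [->|neq_uv] := eqVneq u v; first exact: connect0.
  by apply: connect1; rewrite /e induced_relT adjE neq_uv uv.
have cofactor p : prime p -> (p %| n)%N -> exists v, residue v = (n %/ p)%N.
  move=> p_pr pn; have p_gt1 := prime_gt1 p_pr; have n_gt0 := ltnW n_gt1.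
  have p_lt : (p < n)%N.
    rewrite ltn_neqAle dvdn_leq // andbT.
    by apply: contraNneq n_comp => <-.
  have np_gt1 : (1 < n %/ p)%N by rewrite ltn_divRL // mul1n.
  apply: (@vertex_of_lt (pdiv (n %/ p))); rewrite ?pdiv_prime ?pdiv_dvd //.
    by rewrite (dvdn_trans (pdiv_dvd _)) // dvdn_div.
  by rewrite ltn_Pdiv // ltnW.
move=> u v; have [p [p_pr pn pu]] := residue_prime u; have [q [q_pr qn qv]] := residue_prime v.
have [[a aE] [b bE]] := (cofactor p p_pr pn, cofactor q q_pr qn).
have ua : connect e u a.
  by apply: connect_dvd; rewrite aE -[X in (X %| _)%N](divnK pn) mulnC dvdn_mul.
have vb : connect e v b.
  by apply: connect_dvd; rewrite bE -[X in (X %| _)%N](divnK qn) mulnC dvdn_mul.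
have ab : connect e a b.
  have [pq|pq] := eqVneq p q.
    by rewrite (_ : a = b) //; apply: residue_inj; rewrite aE bE pq.
  apply: connect_dvd; rewrite aE bE -[X in (X %| _)%N](divnK pn).
  apply: dvdn_mul => //.
  rewrite -(@dvdn_pmul2r q) ?prime_gt0 // divnK // Gauss_dvd ?pn ?qn //.
  by rewrite prime_coprime // dvdn_prime2.
by rewrite (connect_trans ua) // (connect_trans ab) // e_sym.
Qed.

(** If mu = kappa, a minimum cut is joined to its complement. The nonadjacent vertices p and q then
    lie on the same side, and every vertex of the other side would be adjacent to both. *)
Lemma zero_divisor_graph_two_primes p q : prime p -> prime q -> p != q ->
  (p %| n)%N -> (q %| n)%N -> n != (p * q)%N ->
  algebraic_connectivity Gamma != (vertex_connectivity Gamma)%:R.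
Proof.
move=> p_pr q_pr pq pn qn npq; apply/eqP => muE.
have cop_pq : coprime p q by rewrite prime_coprime // dvdn_prime2.
have pq_dvd : (p * q %| n)%N by rewrite Gauss_dvd ?pn.
have [p_gt0 q_gt0] := (prime_gt0 p_pr, prime_gt0 q_pr).
have pq_lt : (p * q < n)%N by rewrite ltn_neqAle eq_sym npq dvdn_leq // ltnW.
have n_ndvd : ~~ (n %| p * q)%N by rewrite gtnNdvd ?muln_gt0 ?p_gt0.
have n_comp : ~~ prime n.
  apply/negP => n_pr; have := n_pr.
  by move: pn qn; rewrite !dvdn_prime2 // => /eqP pE /eqP qE; rewrite pE qE eqxx in pq.
have [a aE] : exists v, residue v = p.
  by apply: (vertex_of_lt p_pr); rewrite ?p_gt0 //= (leq_ltn_trans _ pq_lt) // leq_pmulr.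
have [b bE] : exists v, residue v = q.
  by apply: (vertex_of_lt q_pr); rewrite ?q_gt0 //= (leq_ltn_trans _ pq_lt) // leq_pmull.
have ab : a != b by apply: contraNneq pq => ab; rewrite -aE -bE ab.
have nadj : ~~ adj a b by rewrite adjE ab aE bE.
(* If n divides p v and q v, it divides gcd(p, q) v = v. *)
have hub v : ~ (adj a v /\ adj b v).
  rewrite !adjE aE bE => -[/andP[_ av] /andP[_ bv]]; have := residue_ndvd v.
  by rewrite -[X in (_ %| X)%N]mul1n -(eqP cop_pq) muln_gcdl dvdn_gcd av bv.
have [S disS kE] := min_cut_disconnected ab nadj.
have [_ joinS] := algebraic_connectivity_cut disS; rewrite -kE in joinS.
have {}joinS := joinS muE.
have [aS|aT] := boolP (a \in S).
  have bS : b \in S by rewrite -[_ \in _]negbK -in_setC; apply: contra nadj => /(joinS _ _ aS).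
  by case/exists_inP: disS => x xT _; apply: (hub x); split; apply: joinS.
have bT : b \in ~: S.
  rewrite inE; apply: contra nadj => bS; rewrite adj_sym.
  by apply: joinS => //; rewrite inE.
(* With p and q both off [S], no vertex can be left in [S]; an empty cut contradicts
   connectedness. *)
have S0 : S = set0.
  apply/setP => x; rewrite inE; apply/negP => xS.
  by apply: (hub x); split; rewrite adj_sym; apply: joinS; rewrite // inE.
case/exists_inP: disS => x _ /exists_inP[y _].
by rewrite S0 setC0 zero_divisor_graph_connected.
Qed.
End ZeroDivisors.

(** * The integers n with mu = kappa *)

Theorem proposition5p7 (n : nat) (n_ge4 : (4 <= n)%N) (n_composite : ~~ prime n) :
  algebraic_connectivity (zero_divisor_graph n)
    = (vertex_connectivity (zero_divisor_graph n))%:R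
  <-> (exists p q : nat, [/\ prime p, prime q, p != q & n = (p * q)%N])
      \/ (exists p t : nat, [/\ prime p, (3 <= t)%N & n = (p ^ t)%N]).
Proof.
have n_gt1 : (1 < n)%N by apply: leq_trans n_ge4.
split=> [muE|[[p [q [p_pr q_pr pq nE]]]|[p [t [p_pr t_ge3 nE]]]]]; last first.
- exact: (zero_divisor_graph_prime_power n_gt1 p_pr t_ge3 nE).
- case: (ltngtP p q) pq => // lt_pq _.
    exact: (zero_divisor_graph_bipartite n_gt1 p_pr q_pr lt_pq nE).
  by rewrite mulnC in nE; exact: (zero_divisor_graph_bipartite n_gt1 q_pr p_pr lt_pq nE).
have p_pr := pdiv_prime n_gt1; set p := pdiv n in p_pr.
have pn : (p %| n)%N := pdiv_dvd n.
(* Either n is a power of its least prime divisor p, or another prime q divides it. *)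
have [/p_natP[t nE]|] := boolP (p.-nat n).
  (* The exponents 0, 1 and 2 are excluded by n > 1, by compositeness and by the complete case. *)
  right; exists p, t; split=> //; case: t nE => [|[|[|t]]] nE //.
  - by rewrite nE in n_gt1.
  - by rewrite nE expn1 p_pr in n_composite.
  - by have := zero_divisor_graph_complete n_gt1 p_pr nE; rewrite muE eqxx.
rewrite /pnat ltnW //= => /allPn[q]; rewrite mem_primes => /and3P[q_pr _ qn].
rewrite !inE eq_sym => pq; left; exists p, q; split=> //; apply/eqP.
have := zero_divisor_graph_two_primes n_gt1 p_pr q_pr pq pn qn.
by rewrite muE eqxx; case: (n == _) => // /(_ isT).
Qed.
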